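(* Let $\lambda\in\mathbb{C}$, $\lambda\ne1$, $\alpha\in\mathbb{C}$, $m\in\mathbb{Z}_{\ge0}$, $b,c\in\mathbb{C}\setminus\{0\}$, and let $S_n(x)\sim\left(\left(\frac{e^{(\lambda-1)t}-\lambda}{1-\lambda}\right)^{\alpha},\ \frac{t}{e^{ct}(1+bt)^m}\right)$. Then for $n\ge1$, $$S_n(x)=(-1)^{mn}\sum_{l=0}^{n-1}C_{mn}\!\left(l;-\frac{nc}{b}\right)(nc)^l\binom{n-1}{l}A_{n-l}^{(\alpha)}(x\mid\lambda).$$
   Context: For invertible $g(t)$ (nonzero constant term) and delta series $f(t)$ ($f(0)=0$, nonzero coefficient of $t$), the Sheffer sequence $S_n(x)\sim(g(t),f(t))$ is the unique polynomial sequence with $\sum_{k\ge0}S_k(y)\frac{t^k}{k!}=\frac{1}{g(\bar f(t))}e^{y\bar f(t)}$ for all $y\in\mathbb{C}$, where $\bar f$ is the compositional inverse of $f$. Complex powers of series with constant term $1$ are defined by $h^a=\exp(a\log h)$. For $a\ne0$, the Poisson–Charlier polynomials are $C_N(x;a)=\sum_{k=0}^N\binom{N}{k}(-1)^{N-k}a^{-k}(x)_k$, where $(x)_k=x(x-1)\cdots(x-k+1)$. The Frobenius-type Eulerian polynomials of order $\alpha$ are defined by $\left(\frac{1-\lambda}{e^{(\lambda-1)t}-\lambda}\right)^{\alpha}e^{xt}=\sum_{n\ge0}A_n^{(\alpha)}(x\mid\lambda)\frac{t^n}{n!}$. *)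

(* Defs.v *)
From HB Require Import structures.
From mathcomp Require Import all_boot all_order all_algebra.
Set Implicit Arguments. Unset Strict Implicit. Unset Printing Implicit Defensive.
Import Order.TTheory GRing.Theory Num.Theory.
Local Open Scope ring_scope.

Section FPS.
Variable R : fieldType.

Definition fps := nat -> R.

Definition fconst (a : R) : fps := fun n => if n is 0 then a else 0.
Definition fone : fps := fconst 1.
Definition fX : fps := fun n => (n == 1)%:R.
Definition fadd (f g : fps) : fps := fun n => f n + g n.
Definition fsub (f g : fps) : fps := fun n => f n - g n.
Definition fscale (a : R) (f : fps) : fps := fun n => a * f n.
Definition fmul (f g : fps) : fps :=
  fun n => \sum_(i < n.+1) f i * g (n - i)%N.
Fixpoint fpow (f : fps) (k : nat) : fps :=
  match k with 0 => fone | k'.+1 => fmul f (fpow f k') end.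

(* exp h = sum_k h^k / k!, for h with h 0 = 0 (the sum is then finite
   coefficientwise) *)
Definition fexp (h : fps) : fps :=
  fun n => \sum_(k < n.+1) fpow h k n / (k`!)%:R.
(* log h = sum_{k>=1} (-1)^(k+1) (h-1)^k / k, for h with h 0 = 1 *)
Definition flog (h : fps) : fps :=
  fun n => \sum_(k < n.+1)
     (if nat_of_ord k is 0 then 0 else (-1) ^+ k.+1 / k%:R * fpow (fsub h fone) k n).
Definition fcpow (h : fps) (a : R) : fps := fexp (fscale a (flog h)).

(* composition f(h(t)), for h with h 0 = 0 *)
Definition fcomp (f h : fps) : fps :=
  fun n => \sum_(k < n.+1) f k * fpow h k n.

(* multiplicative inverse of a series with nonzero constant term *)
Fixpoint finv_aux (g : fps) (n : nat) : seq R :=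
  match n with
  | 0 => [:: (g 0%N)^-1]
  | n'.+1 => let s := finv_aux g n' in
      rcons s (- (g 0%N)^-1 * \sum_(i < n'.+1) g i.+1 * s`_(n' - i))
  end.
Definition finv (g : fps) : fps := fun n => (finv_aux g n)`_n.

Definition is_compinv (f fb : fps) : Prop := fb 0%N = 0 /\ fcomp f fb = fX.

(* S ~ (g, f), given the compositional inverse fb of f:
   sum_k S_k(y) t^k/k! = 1/g(fb t) * exp(y fb t) for all y *)
Definition is_sheffer (S : nat -> {poly R}) (g fb : fps) : Prop :=
  forall (y : R) (k : nat),
    (S k).[y] / (k`!)%:R = fmul (finv (fcomp g fb)) (fexp (fscale y fb)) k.

Definition ffall (x : R) (k : nat) : R := \prod_(i < k) (x - i%:R).

Definition charlier (N : nat) (x a : R) : R :=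
  \sum_(k < N.+1) 'C(N, k)%:R * (-1) ^+ (N - k) * a ^- k * ffall x k.

Definition eulerA (al lam : R) (n : nat) (x : R) : R :=
  (n`!)%:R *
  fmul (fcpow (fscale (1 - lam)
                 (finv (fsub (fexp (fscale (lam - 1) fX)) (fconst lam)))) al)
       (fexp (fscale x fX)) n.

Definition g_ser (al lam : R) : fps :=
  fcpow (fscale (1 - lam)^-1 (fsub (fexp (fscale (lam - 1) fX)) (fconst lam))) al.

Definition f_ser (b c : R) (m : nat) : fps :=
  fmul fX (finv (fmul (fexp (fscale c fX)) (fpow (fadd fone (fscale b fX)) m))).

End FPS.

(* Main.v *)
Require Import Defs.
From HB Require Import structures.
From mathcomp Require Import all_boot all_order all_algebra.
From mathcomp Require Import boolp ring.
Set Implicit Arguments.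
Unset Strict Implicit.
Unset Printing Implicit Defensive.
Import Order.TTheory GRing.Theory Num.Theory.
Local Open Scope ring_scope.

(** Let [phi = e^(ct) (1+bt)^m], so that [f = t/phi], and let [H] be the
generating series of [A_k(x)/k!]. Complex powers satisfy [u^a (1/u)^a = 1],
hence [S_n(x)/n!] is the coefficient of [t^n] in [H(fb(t))], and Lagrange
inversion gives [S_n(x)/(n-1)! = [t^(n-1)] H'(t) phi(t)^n]. The coefficients of
[phi^n = e^(nct) (1+bt)^(mn)] are the Charlier polynomials, up to the symmetry
[C(N,k) (l)_k = C(l,k) (N)_k]. *)

(** * The commutative ring of formal power series *)

Section Ring.
Variable R : fieldType.
Implicit Types (f g h : fps R) (n : nat).

Lemma fpsP f g : (forall n, f n = g n) -> f = g.
Proof. by move=> fg; apply: funext. Qed.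

(** Coefficients below [N] of a product depend only on these truncations, so the laws of
    multiplication are inherited from [{poly R}]. *)
Definition trunc N f : {poly R} := \poly_(i < N) f i.

Lemma fmul_trunc N f g n : (n < N)%N ->
  fmul f g n = (trunc N f * trunc N g)`_n.
Proof.
move=> nN; rewrite coefM; apply: eq_bigr => i _; rewrite !coef_poly.
by rewrite (leq_ltn_trans (leq_subr i n) nN) (leq_ltn_trans (leq_ord i) nN).
Qed.

Lemma trunc_mul N f g : trunc N (fmul f g) = take_poly N (trunc N f * trunc N g).
Proof.
apply/polyP => i; rewrite coef_poly coef_take_poly.
by case: ifP => // iN; rewrite (@fmul_trunc N).
Qed.

Lemma fmulC : commutative (@fmul R).
Proof.
by move=> f g; apply: fpsP => n; rewrite !(@fmul_trunc n.+1) // mulrC.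
Qed.

Lemma fmulA : associative (@fmul R).
Proof.
move=> f g h; apply: fpsP => n; rewrite !(@fmul_trunc n.+1) // !trunc_mul.
(* Coefficient [n] of a product never reads a factor beyond degree [n], so the inner truncation is
   invisible. *)
have tE (p q : {poly R}) : (take_poly n.+1 p * q)`_n = (p * q)`_n.
  rewrite !coefM; apply: eq_bigr => i _.
  by rewrite coef_take_poly ltn_ord.
by rewrite tE mulrC tE mulrC mulrA.
Qed.

Lemma fmul1 : left_id (fone R) (@fmul R).
Proof.
move=> f; apply: fpsP => n; rewrite /fmul big_ord_recl subn0 mul1r.
by rewrite big1 ?addr0 // => i _; rewrite mul0r.
Qed.

Lemma fmulDl : left_distributive (@fmul R) (@fadd R).
Proof.
move=> f g h; apply: fpsP => n; rewrite /fmul /fadd -big_split.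
by apply: eq_bigr => i _; rewrite mulrDl.
Qed.

Lemma faddA : associative (@fadd R).
Proof. by move=> f g h; apply: fpsP => n; apply: addrA. Qed.
Lemma faddC : commutative (@fadd R).
Proof. by move=> f g; apply: fpsP => n; apply: addrC. Qed.
Lemma fadd0 : left_id (fconst 0) (@fadd R).
Proof. by move=> f; apply: fpsP => -[|n]; apply: add0r. Qed.
Lemma faddN : left_inverse (fconst 0) (fun f : fps R => (fun n => - f n) : fps R) (@fadd R).
Proof. by move=> f; apply: fpsP => -[|n]; apply: addNr. Qed.
Lemma fone_neq0 : fone R <> fconst 0.
Proof. by move/(congr1 (fun f : fps R => f 0%N))/eqP; rewrite oner_eq0. Qed.

End Ring.

(** Equality and choice on series, which are functions on [nat], are classical; the algebraic
    structures are built on top of them. *)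
HB.instance Definition _ (R : fieldType) := gen_eqMixin (fps R).
HB.instance Definition _ (R : fieldType) := gen_choiceMixin (fps R).
HB.instance Definition _ (R : fieldType) :=
  GRing.isZmodule.Build (fps R) (@faddA R) (@faddC R) (@fadd0 R) (@faddN R).
HB.instance Definition _ (R : fieldType) :=
  GRing.Zmodule_isComNzRing.Build (fps R) (@fmulA R) (@fmulC R) (@fmul1 R)
    (@fmulDl R) (introN eqP (@fone_neq0 R)).

(* [fingraph.finv] shadows the multiplicative inverse of series. *)
Local Notation finv := Defs.finv.

(** * Coefficients, inverses and composition of series *)

Section Comp.
Variable R : fieldType.
Implicit Types (f g h : fps R) (n : nat).

Lemma fps0E n : (0 : fps R) n = 0. Proof. by case: n. Qed.
Lemma fpsDE f g n : (f + g) n = f n + g n. Proof. by []. Qed.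
Lemma fpsBE f g n : (f - g) n = f n - g n. Proof. by []. Qed.
Lemma fpsME f g n : (f * g) n = \sum_(i < n.+1) f i * g (n - i)%N.
Proof. by []. Qed.
Lemma fpsME0 f g : (f * g) 0%N = f 0%N * g 0%N.
Proof. by rewrite fpsME big_ord1. Qed.
Lemma fps_sumE (I : Type) (r : seq I) (P : pred I) (F : I -> fps R) n :
  (\sum_(i <- r | P i) F i) n = \sum_(i <- r | P i) F i n.
Proof. exact: (big_morph (fun f : fps R => f n) (fun f g => fpsDE f g n) (fps0E n)). Qed.

Lemma fpowE f k : fpow f k = f ^+ k.
Proof. by elim: k => // k IH; rewrite exprS /= IH. Qed.
Lemma fsubE f g : fsub f g = f - g. Proof. by []. Qed.

Lemma fconst_is_zmod_morphism : zmod_morphism (@fconst R).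
Proof. by move=> a b; apply: fpsP => -[|n] //; rewrite fpsBE /= subr0. Qed.
Lemma fconst_is_monoid_morphism : monoid_morphism (@fconst R).
Proof.
split=> // a b; apply: fpsP => -[|n]; rewrite fpsME ?big_ord1 //=.
by rewrite big1 // => -[[|i] Hi] _ /=; rewrite ?mulr0 ?mul0r.
Qed.
HB.instance Definition _ :=
  GRing.isZmodMorphism.Build R (fps R) (@fconst R) fconst_is_zmod_morphism.
HB.instance Definition _ :=
  GRing.isMonoidMorphism.Build R (fps R) (@fconst R) fconst_is_monoid_morphism.

Lemma fconstME a f n : (fconst a * f) n = a * f n.
Proof.
rewrite fpsME big_ord_recl subn0 big1 ?addr0 // => i _.
by rewrite /= mul0r.
Qed.
Lemma fscaleE a f : fscale a f = fconst a * f.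
Proof. by apply: fpsP => n; rewrite fconstME. Qed.

Lemma fXME f n : (fX R * f) n = if n is n'.+1 then f n' else 0.
Proof.
case: n => [|n]; first by rewrite fpsME0 mul0r.
rewrite fpsME !big_ord_recl mul0r add0r mul1r big1 ?addr0 ?subSS ?subn0 //.
by move=> i _; rewrite /fX /= mul0r.
Qed.
Lemma fX_exprME f k n : (fX R ^+ k * f) n = if (k <= n)%N then f (n - k)%N else 0.
Proof.
elim: k n => [|k IH] n; first by rewrite expr0 mul1r subn0.
by rewrite exprS -mulrA fXME; case: n => // n; rewrite IH.
Qed.
Lemma fX_exprE k n : (fX R ^+ k) n = (n == k)%:R.
Proof.
rewrite -[_ ^+ _]mulr1 fX_exprME; case: ltngtP => [lt|//|->].
  by rewrite -subn_gt0 in lt; case: (n - k)%N lt.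
by rewrite subnn.
Qed.

Lemma fps_low_factor h : h 0%N = 0 -> exists g, h = fX R * g.
Proof.
move=> h0; exists (fun n => h n.+1); apply: fpsP => -[|n]; by rewrite fXME.
Qed.
(** A series without constant term is a multiple of [X], so its [k]-th power is a multiple of
    [X^k]. *)
Lemma expr_low h k n g : h 0%N = 0 -> (n < k)%N -> (h ^+ k * g) n = 0.
Proof.
move=> /fps_low_factor [u ->] nk.
by rewrite exprMn -mulrA fX_exprME leqNgt nk.
Qed.
Lemma expr_low1 h k n : h 0%N = 0 -> (n < k)%N -> (h ^+ k) n = 0.
Proof. by move=> h0 nk; rewrite -[_ ^+ _]mulr1 expr_low. Qed.

Lemma finv_recl g n : finv g n.+1 =
  - (g 0%N)^-1 * \sum_(i < n.+1) g i.+1 * finv g (n - i)%N.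
Proof.
have sz k : size (finv_aux g k) = k.+1.
  by elim: k => // k IH; rewrite /= size_rcons IH.
(* Each list only extends the previous one, so an entry, once computed, stays the same. *)
have nthE k i : (i <= k)%N -> (finv_aux g k)`_i = finv g i.
  elim: k => [|k IH]; first by rewrite leqn0 => /eqP ->.
  rewrite leq_eqVlt => /orP[/eqP -> //|ik].
  by rewrite /= nth_rcons sz ik IH.
rewrite /finv /= nth_rcons sz ltnn eqxx; congr (_ * _).
by apply: eq_bigr => i _; rewrite nthE // leq_subr.
Qed.

Lemma fmulfV g : g 0%N != 0 -> g * finv g = 1.
Proof.
move=> g0; apply: fpsP => -[|n]; first by rewrite fpsME0 mulfV.
rewrite fpsME big_ord_recl subn0 finv_recl mulrA mulrN mulfV // mulN1r.
by apply/eqP; rewrite addrC subr_eq0; apply/eqP/eq_bigr => i _; rewrite subSS.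
Qed.

Lemma finv_unique g h : g * h = 1 -> finv g = h.
Proof.
move=> gh; rewrite -[finv g]mulr1 -gh mulrA [finv g * g]mulrC fmulfV ?mul1r //.
apply/eqP => g0; have /eqP := congr1 (fun f : fps R => f 0%N) gh.
by rewrite fpsME0 g0 mul0r eq_sym oner_eq0.
Qed.

(** Polynomial evaluation in the ring of series stands in for composition up to a given degree, and
    makes [hornerM] available. *)
Definition fhorner (p : {poly R}) h : fps R := (map_poly (@fconst R) p).[h].

Lemma fhornerE N f h :
  fhorner (trunc N f) h = \sum_(k < N) fconst (f k) * h ^+ k.
Proof.
rewrite /fhorner (@horner_coef_wide _ N) => [|//].
  by apply: eq_bigr => i _; rewrite coef_map coef_poly ltn_ord.
by apply: leq_trans (size_poly _ _) (size_poly _ _).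
Qed.

Lemma fcomp_fhorner N f h n : h 0%N = 0 -> (n < N)%N ->
  fcomp f h n = fhorner (trunc N f) h n.
Proof.
move=> h0 nN; rewrite fhornerE fps_sumE /fcomp.
under [RHS]eq_bigr do rewrite fconstME.
rewrite (big_ord_widen N (fun k => f k * fpow h k n)) //.
rewrite [RHS](bigID (fun k : 'I_N => k < n.+1)%N) /= [X in _ + X]big1 ?addr0.
  by apply: eq_bigr => i _; rewrite fpowE.
by move=> i; rewrite -leqNgt => ni; rewrite expr_low1 ?mulr0.
Qed.

Lemma fcompM f g h : h 0%N = 0 -> fcomp (f * g) h = fcomp f h * fcomp g h.
Proof.
move=> h0; apply: fpsP => n.
have -> : (fcomp f h * fcomp g h) n =
    (fhorner (trunc n.+1 f) h * fhorner (trunc n.+1 g) h) n.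
  rewrite !fpsME; apply: eq_bigr => i _; congr (_ * _); apply: fcomp_fhorner => //.
  by rewrite ltnS leq_subr.
rewrite (@fcomp_fhorner n.+1) // trunc_mul.
rewrite /fhorner -hornerM -rmorphM.
(* The product splits into its part of degree at most [n] and a multiple of [X^(n+1)]; the latter
   evaluates to a multiple of [h^(n+1)], which has no coefficient of index [n]. *)
rewrite -[in RHS](poly_take_drop n.+1 (trunc n.+1 f * trunc n.+1 g)).
rewrite rmorphD rmorphM /= map_polyXn hornerD hornerM hornerXn fpsDE.
by rewrite [X in _ + X n]mulrC expr_low // addr0.
Qed.

Lemma fcompD f g h : fcomp (f + g) h = fcomp f h + fcomp g h.
Proof.
apply: fpsP => n; rewrite fpsDE /fcomp -big_split.
by apply: eq_bigr => k _; rewrite fpsDE mulrDl.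
Qed.
Lemma fcomp1 h : fcomp 1 h = 1.
Proof.
apply: fpsP => n; rewrite /fcomp big_ord_recl mul1r big1 ?addr0 //.
by move=> i _; rewrite mul0r.
Qed.
Lemma fcompX h : h 0%N = 0 -> fcomp (fX R) h = h.
Proof.
move=> h0; apply: fpsP => -[|n]; first by rewrite /fcomp big_ord1 mul0r h0.
rewrite /fcomp !big_ord_recl mul0r add0r mul1r fpowE expr1 big1 ?addr0 //.
by move=> i _; rewrite /fX /= mul0r.
Qed.
Lemma fcomp_exp f h k : h 0%N = 0 -> fcomp (f ^+ k) h = fcomp f h ^+ k.
Proof.
move=> h0; elim: k => [|k IH]; first by rewrite !expr0 fcomp1.
by rewrite !exprS fcompM // IH.
Qed.
Lemma fcomp0 f h : fcomp f h 0%N = f 0%N.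
Proof. by rewrite /fcomp big_ord1 mulr1. Qed.

(** Powers of [h] beyond the [n]-th do not reach degree [n], even after multiplication by [g]. This
    form serves the chain rule and Lagrange inversion. *)
Lemma fcompME f g h n : h 0%N = 0 ->
  (fcomp f h * g) n = \sum_(k < n.+1) f k * (h ^+ k * g) n.
Proof.
move=> h0.
have -> : (fcomp f h * g) n = (fhorner (trunc n.+1 f) h * g) n.
  rewrite !fpsME; apply: eq_bigr => i _; congr (_ * _).
  exact: fcomp_fhorner.
rewrite fhornerE mulr_suml fps_sumE.
by apply: eq_bigr => k _; rewrite -mulrA fconstME.
Qed.

(** * The formal derivative *)

Definition fderiv f : fps R := fun n => n.+1%:R * f n.+1.

Lemma fderivD f g : fderiv (f + g) = fderiv f + fderiv g.
Proof. by apply: fpsP => n; rewrite /fderiv !fpsDE mulrDr. Qed.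
Lemma fderivM f g : fderiv (f * g) = fderiv f * g + f * fderiv g.
Proof.
apply: fpsP => n; rewrite fpsDE {1}/fderiv fpsME mulr_sumr.
(* The weight [n+1] is shared as [i + (n+1-i)] between the two factors. *)
have -> : \sum_(i < n.+2) n.+1%:R * (f i * g (n.+1 - i)%N) =
   \sum_(i < n.+2) (i%:R * f i) * g (n.+1 - i)%N +
   \sum_(i < n.+2) f i * ((n.+1 - i)%:R * g (n.+1 - i)%N).
  rewrite -big_split; apply: eq_bigr => i _ /=.
  by rewrite -[X in X%:R](subnKC (leq_ord i)) natrD; ring.
congr (_ + _).
  by rewrite big_ord_recl !mul0r add0r.
rewrite big_ord_recr /= subnn mul0r mulr0 addr0.
by apply: eq_bigr => i _; rewrite /fderiv subSn // leq_ord.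
Qed.
Lemma fderiv_const a : fderiv (fconst a) = 0.
Proof. by apply: fpsP => n; rewrite fps0E /fderiv mulr0. Qed.
Lemma fderivX : fderiv (fX R) = 1.
Proof. by apply: fpsP => -[|n]; rewrite /fderiv /fX ?mulr1 ?mulr0. Qed.
Lemma fderivZ a f : fderiv (fconst a * f) = fconst a * fderiv f.
Proof. by rewrite fderivM fderiv_const mul0r add0r. Qed.
Lemma fderiv_exp f k : fderiv (f ^+ k.+1) = k.+1%:R * f ^+ k * fderiv f.
Proof.
elim: k => [|k IH]; first by rewrite !mul1r.
by rewrite exprS fderivM IH (exprS f k) -[k.+2]addn1 natrD; ring.
Qed.

Lemma fderiv_comp f h : h 0%N = 0 ->
  fderiv (fcomp f h) = fcomp (fderiv f) h * fderiv h.
Proof.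
move=> h0; apply: fpsP => n; rewrite fcompME //.
rewrite {1}/fderiv /fcomp big_ord_recl mulrDr fpowE expr0.
rewrite [X in _ * (_ * X)](_ : _ = 0) // !mulr0 add0r mulr_sumr.
apply: eq_bigr => k _; rewrite fpowE lift0.
(* The power rule, read at coefficient [n], matches the two sums term by term. *)
have := congr1 (fun f : fps R => f n) (fderiv_exp h k).
rewrite -(rmorph_nat (@fconst R)) -mulrA fconstME /fderiv => E.
by rewrite mulrCA E; ring.
Qed.

End Comp.

(** * Exponential, logarithm and complex powers *)

Section ExpLog.
Variable R : numFieldType.
Implicit Types (f g h u v : fps R) (a y : R) (n : nat).

(** In characteristic 0 every factor [n+1] can be cancelled. *)
Lemma fderiv_inj f g : fderiv f = fderiv g -> f 0%N = g 0%N -> f = g.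
Proof.
move=> dfg fg0; apply: fpsP => -[//|n].
have := congr1 (fun f : fps R => f n) dfg; rewrite /fderiv => /mulfI -> //.
by rewrite pnatr_eq0.
Qed.

Lemma fexpE h : fexp h = fcomp (fun k => k`!%:R^-1) h.
Proof. by apply: fpsP => n; apply: eq_bigr => k _; rewrite mulrC. Qed.

Lemma fexp0 h : fexp h 0%N = 1.
Proof. by rewrite fexpE fcomp0 invr1. Qed.

Lemma fderiv_fexp h : h 0%N = 0 ->
  fderiv (fexp h) = fexp h * fderiv h.
Proof.
move=> h0; rewrite fexpE fderiv_comp //; congr (fcomp _ h * _).
apply: fpsP => n; rewrite /fderiv factS natrM invfM mulrA mulfV ?mul1r //.
by rewrite pnatr_eq0.
Qed.

Lemma flogE u : flog u =
  fcomp (fun k => if k is 0 then 0 else (-1) ^+ k.+1 / k%:R) (u - 1).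
Proof.
apply: fpsP => n; apply: eq_bigr => -[[|k] Hk] _ //=.
by rewrite mul0r.
Qed.

Lemma flog0 u : flog u 0%N = 0.
Proof. by rewrite flogE fcomp0. Qed.

Lemma fderiv_flog u : u 0%N = 1 -> fderiv (flog u) * u = fderiv u.
Proof.
move=> u0; have h0 : (u - 1) 0%N = 0 by rewrite fpsBE u0 subrr.
rewrite flogE fderiv_comp //.
set L := fderiv _.
(* [L] is the geometric series with coefficients [(-1)^k], and [1 + X] composed with [u - 1] gives
   [u]. *)
have LE : L * (1 + fX R) = 1.
  apply: fpsP => n; rewrite mulrDr mulr1 fpsDE mulrC fXME {}/L.
  have dE k : (k.+1%:R : R) * ((-1) ^+ k.+2 / k.+1%:R) = (-1) ^+ k.
    by rewrite mulrCA mulfV ?pnatr_eq0 // mulr1 !exprS mulrA mulrNN !mul1r.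
  by case: n => [|n]; rewrite /fderiv !dE ?addr0 // exprS mulN1r addNr.
have -> : fderiv (u - 1) = fderiv u.
  by rewrite fderivD (_ : - 1 = fconst (-1)) ?fderiv_const ?addr0 // rmorphN.
have uE : fcomp (1 + fX R) (u - 1) = u.
  by rewrite fcompD fcomp1 fcompX // addrC subrK.
by rewrite mulrAC -{2}uE -fcompM // LE fcomp1 mul1r.
Qed.

Lemma fcpow0 u a : fcpow u a 0%N = 1.
Proof. exact: fexp0. Qed.

Lemma fderiv_fcpow u a : fderiv (fcpow u a) =
  fcpow u a * (fconst a * fderiv (flog u)).
Proof.
by rewrite /fcpow fderiv_fexp fscaleE ?fderivZ // fconstME flog0 mulr0.
Qed.

(* [fcpow u a * fcpow v a] has zero derivative, as the logarithmic derivatives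
   of [u] and [v] are opposite *)
Lemma fcpow_mulV u v a : u 0%N = 1 -> u * v = 1 -> fcpow u a * fcpow v a = 1.
Proof.
move=> u0 uv.
have v0 : v 0%N = 1.
  by have := congr1 (fun f : fps R => f 0%N) uv; rewrite fpsME0 u0 mul1r.
apply: fderiv_inj; last by rewrite fpsME0 !fcpow0 mul1r.
rewrite (fderiv_const 1) fderivM !fderiv_fcpow.
have dlog : fderiv (flog u) + fderiv (flog v) = 0.
  rewrite -[LHS]mulr1 -{1}uv.
  transitivity (fderiv (flog u) * u * v + u * (fderiv (flog v) * v)).
    by ring.
  by rewrite !fderiv_flog // -fderivM uv (fderiv_const 1).
transitivity (fcpow u a * fcpow v a * fconst a *
  (fderiv (flog u) + fderiv (flog v))); first by ring.
by rewrite dlog mulr0.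
Qed.

(** * Exponential and binomial series, and Lagrange inversion *)

Lemma fpow_fscale y h k n : fpow (fscale y h) k n = y ^+ k * (h ^+ k) n.
Proof. by rewrite fpowE fscaleE exprMn -rmorphXn fconstME. Qed.

Lemma fexpXE y k : fexp (fscale y (fX R)) k = y ^+ k / k`!%:R.
Proof.
rewrite /fexp big_ord_recr /= fpow_fscale fX_exprE eqxx mulr1.
rewrite big1 ?add0r // => i _; rewrite fpow_fscale fX_exprE.
by rewrite gtn_eqF ?ltn_ord // mulr0 mul0r.
Qed.

Lemma fexp_comp y h : fexp (fscale y h) = fcomp (fexp (fscale y (fX R))) h.
Proof.
apply: fpsP => n; apply: eq_bigr => k _.
by rewrite fexpXE fpow_fscale fpowE mulrAC.
Qed.

Lemma fexpXD y z : fexp (fscale (y + z) (fX R)) =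
  fexp (fscale y (fX R)) * fexp (fscale z (fX R)).
Proof.
apply: fpsP => n; rewrite fpsME fexpXE addrC exprDn mulr_suml.
apply: eq_bigr => i _; rewrite !fexpXE -mulr_natr.
have -> : n`!%:R = ('C(n, i) * (i`! * (n - i)`!))%:R :> R.
  by rewrite bin_fact // leq_ord.
rewrite !natrM; field.
by rewrite !pnatr_eq0 -!lt0n !fact_gt0 bin_gt0 leq_ord.
Qed.

Lemma fexpX_expr y n : fexp (fscale y (fX R)) ^+ n = fexp (fscale (n%:R * y) (fX R)).
Proof.
elim: n => [|n IH]; last first.
  by rewrite exprS IH -fexpXD -[n.+1]add1n natrD mulrDl mul1r.
apply: fpsP => -[|k]; rewrite mul0r fexpXE ?divr1 //.
by rewrite exprS !mul0r.
Qed.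

Lemma binomial_series b N k : ((1 + fconst b * fX R) ^+ N) k = 'C(N, k)%:R * b ^+ k.
Proof.
rewrite exprDn fps_sumE.
have tE (i : 'I_N.+1) : (1 ^+ (N - i) * (fconst b * fX R) ^+ i *+ 'C(N, i)) k =
   if i == k :> nat then 'C(N, k)%:R * b ^+ k else 0.
  rewrite expr1n mul1r exprMn -mulr_natl -(rmorph_nat (@fconst R)) fconstME.
  rewrite -rmorphXn fconstME fX_exprE eq_sym; case: eqP => [->|_].
    by rewrite mulr1.
  by rewrite !mulr0.
under eq_bigr do rewrite tE.
case: (leqP k N) => kN; last first.
  rewrite bin_small // mul0r big1 // => i _; by case: ifP.
rewrite (bigD1 (Ordinal (kN : (k < N.+1)%N))) //= eqxx big1 ?addr0 // => i /eqP ik.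
by case: eqP => // e; case: ik; apply: val_inj.
Qed.

(* This is the residue of [w^(j-n) w'] at [0] for [i = n - 1 - j]: it vanishes
   for [i > 0] since [X (P^i)'] and [i P^i] agree in degree [i]. *)
Lemma lagrange_residue (w P : fps R) i : w 0%N = 0 -> w * P = fX R ->
  (fderiv w * P ^+ i.+1) i = (i == 0%N)%:R.
Proof.
move=> w0 wP.
(* Differentiating [w P = X] eliminates the derivative of [w]. *)
have dwP : fderiv w * P = 1 - w * fderiv P.
  by rewrite -(fderivX R) -wP fderivM addrK.
rewrite exprS mulrA dwP mulrBl mul1r.
case: i => [|i].
  by rewrite !expr0 mulr1 fpsBE fpsME0 w0 mul0r subr0.
have dP : i.+1%:R * (w * fderiv P * P ^+ i.+1) = fX R * fderiv (P ^+ i.+1).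
  by rewrite fderiv_exp -wP exprS; ring.
have := congr1 (fun f : fps R => f i.+1) dP.
rewrite fXME /fderiv -(rmorph_nat (@fconst R)) fconstME => /mulfI E.
by rewrite fpsBE E ?subrr // pnatr_eq0.
Qed.

(** With [P = psi(w)] and [K = H' phi^(n+1)], the chain rule gives [(H(w))' = K(w) P^(n+1) w'].
    Expanding [K] in powers of [w] and using [w P = X], the [j]-th term becomes [X^j P^(n-j+1) w'],
    and by [lagrange_residue] only [j = n] survives. *)
Lemma lagrange_inversion (psi phi w H : fps R) n : w 0%N = 0 ->
  psi * phi = 1 -> fcomp (fX R * psi) w = fX R ->
  n.+1%:R * fcomp H w n.+1 = (fderiv H * phi ^+ n.+1) n.
Proof.
move=> w0 pp; rewrite fcompM // fcompX // => wP.
set P := fcomp psi w in wP.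
have -> : n.+1%:R * fcomp H w n.+1 = fderiv (fcomp H w) n by [].
rewrite fderiv_comp //.
set K := fderiv H * phi ^+ n.+1.
have -> : fderiv H = K * psi ^+ n.+1.
  by rewrite -mulrA -exprMn [phi * _]mulrC pp expr1n mulr1.
rewrite fcompM // fcomp_exp // -/P -mulrA fcompME //.
have tE (j : 'I_n.+1) : K j * (w ^+ j * (P ^+ n.+1 * fderiv w)) n =
    K j * (n - j == 0)%N%:R.
  rewrite -(lagrange_residue _ w0 wP); congr (_ * _).
  have jn := leq_ord j.
  have -> : P ^+ n.+1 = P ^+ j * P ^+ (n - j).+1 by rewrite -exprD addnS subnKC.
  rewrite -mulrA [w ^+ j * _]mulrA -exprMn wP.
  by rewrite fX_exprME jn mulrC.
under eq_bigr do rewrite tE.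
rewrite big_ord_recr /= subnn eqxx mulr1 big1 ?add0r // => j _.
by rewrite subn_eq0 leqNgt ltn_ord mulr0.
Qed.

(** * Charlier polynomials as series coefficients *)

Lemma ffall_nat (l k : nat) : ffall (l%:R : R) k = (l ^_ k)%:R.
Proof.
rewrite /ffall; elim: k => [|k IH]; first by rewrite big_ord0.
rewrite big_ord_recr /= IH ffactnSr natrM; case: (leqP k l) => kl.
  by rewrite natrB.
by rewrite ffact_small // !mul0r.
Qed.

Lemma charlier_coef (a b : R) N l : a != 0 -> b != 0 ->
  (-1) ^+ N * (charlier N l%:R (- a / b) * a ^+ l) =
  l`!%:R * (fexp (fscale a (fX R)) * (1 + fconst b * fX R) ^+ N) l.
Proof.
move=> a0 b0.
(* The common summand of both sides. It vanishes for [k > N] by the binomial and for [k > l] by the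
   falling factorial, so sums up to [N] and up to [l] both equal the sum up to [N + l]. *)
pose F k := 'C(N, k)%:R * b ^+ k * a ^+ (l - k) * (l ^_ k)%:R.
have padF (p : nat) : (p <= N + l)%N ->
    (forall k, (p < k)%N -> F k = 0) ->
    \sum_(k < p.+1) F k = \sum_(k < (N + l).+1) F k.
  move=> pNl F0; rewrite (big_ord_widen (N + l).+1 F) //.
  rewrite [RHS](bigID (fun k : 'I__ => k < p.+1)%N) /=.
  by rewrite [X in _ + X]big1 ?addr0 // => k; rewrite -leqNgt; apply: F0.
transitivity (\sum_(k < N.+1) F k).
  rewrite /charlier mulr_suml mulr_sumr; apply: eq_bigr => k _.
  (* For [k > l] the subtraction in [a ^+ (l - k)] is truncated, but both terms vanish. *)
  rewrite ffall_nat /F; case: (leqP k l) => kl; last first.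
    by rewrite ffact_small // !(mulr0, mul0r).
  have sqr_sign i : (-1) ^+ i * (-1) ^+ i = 1 :> R.
    by rewrite -exprMn mulrNN mulr1 expr1n.
  have -> : (- a / b) ^- k = (-1) ^+ k * b ^+ k / a ^+ k.
    by rewrite expr_div_n invf_div (exprNn a) invr_signM mulrCA mulrA.
  have -> : (-1) ^+ N = (-1) ^+ k * (-1) ^+ (N - k) :> R.
    by rewrite -exprD subnKC // -ltnS.
  have -> : a ^+ l = a ^+ k * a ^+ (l - k) by rewrite -exprD subnKC.
  (* The signs from the prefactor, the Charlier coefficient and the negative argument pair up into
     squares. *)
  transitivity ('C(N, k)%:R * b ^+ k * a ^+ (l - k) * (l ^_ k)%:R *
      ((-1) ^+ k * (-1) ^+ k) * ((-1) ^+ (N - k) * (-1) ^+ (N - k))).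
    by field; rewrite expf_neq0.
  by rewrite !sqr_sign !mulr1.
rewrite (padF N) ?leq_addr //; last by move=> k Nk; rewrite /F bin_small // !mul0r.
rewrite -(padF l) ?leq_addl //; last by move=> k lk; rewrite /F ffact_small // mulr0.
rewrite [fexp _ * _]mulrC fpsME mulr_sumr; apply: eq_bigr => k _.
rewrite binomial_series fexpXE /F -(ffact_fact (leq_ord k)) natrM; field.
by rewrite pnatr_eq0 -lt0n fact_gt0.
Qed.

End ExpLog.

(** * The Sheffer sequence in terms of Charlier and Eulerian polynomials *)

Theorem theorem10 (R : numClosedFieldType) (lam al b c : R) (m : nat)
  (fb : fps R) (S : nat -> {poly R}) :
  lam != 1 -> b != 0 -> c != 0 ->
  is_compinv (f_ser b c m) fb ->
  is_sheffer S (g_ser al lam) fb ->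
  forall (n : nat) (x : R), (1 <= n)%N ->
    (S n).[x] = (-1) ^+ (m * n) *
      \sum_(l < n) charlier (m * n) l%:R (- (n%:R * c) / b)
                   * (n%:R * c) ^+ l * 'C(n.-1, l)%:R * eulerA al lam (n - l) x.
Proof.
(* From here on the index of the statement is [n.+1], so its [n.-1] is the present [n]. *)
move=> lam1 b0 c0 [fb0 fbE] SE [//|n] x _.
set G : fps R := fcpow (fscale (1 - lam)
  (finv (fsub (fexp (fscale (lam - 1) (fX R))) (fconst lam)))) al.
set H : fps R := G * fexp (fscale x (fX R)).
pose phi : fps R := fexp (fscale c (fX R)) * (1 + fconst b * fX R) ^+ m.
(* The two bases are reciprocal with constant term 1, thanks to [lam != 1]. *)
have gG : g_ser al lam * G = 1.
  have lam0 : 1 - lam != 0 by rewrite subr_eq0 eq_sym.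
  have D0 : (fexp (fscale (lam - 1) (fX R)) - fconst lam) 0%N = 1 - lam.
    by rewrite fpsBE fexp0.
  apply: fcpow_mulV; first by rewrite fscaleE fconstME fsubE D0 mulVf.
  rewrite !fscaleE !fsubE mulrACA -rmorphM mulVf // rmorph1 mul1r fmulfV //.
  by rewrite -fscaleE D0.
have SH : (S n.+1).[x] = n.+1`!%:R * fcomp H fb n.+1.
  have nz : n.+1`!%:R != 0 :> R by rewrite pnatr_eq0 -lt0n fact_gt0.
  rewrite -[LHS](divfK nz) mulrC SE; congr (_ * _).
  rewrite (@finv_unique _ _ (fcomp G fb)); last by rewrite -fcompM // gG fcomp1.
  by rewrite fexp_comp fcompM.
have phi0 : phi 0%N = 1 by rewrite /phi fpsME0 fexp0 binomial_series bin0 !mul1r.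
have phiE : fmul (fexp (fscale c (fX R))) (fpow (fadd (fone R) (fscale b (fX R))) m) = phi.
  by rewrite fpowE (fscaleE b).
have fE : fcomp (fX R * finv phi) fb = fX R by rewrite -[RHS]fbE -phiE.
have finvM : finv phi * phi = 1 by rewrite mulrC fmulfV // phi0 oner_eq0.
(* One factor [n+1] of the factorial is absorbed by Lagrange inversion, which leaves [n!]. *)
rewrite SH factS mulnC natrM -mulrA (lagrange_inversion H n fb0 finvM fE).
rewrite mulrC [fderiv _ * _]mulrC fpsME mulr_suml mulr_sumr.
have phiX : phi ^+ n.+1 =
    fexp (fscale (n.+1%:R * c) (fX R)) * (1 + fconst b * fX R) ^+ (m * n.+1).
  by rewrite exprMn fexpX_expr exprM.
apply: eq_bigr => l _; have ln := leq_ord l.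
rewrite -(mulrA _ 'C(_, _)%:R) [(-1) ^+ _ * _]mulrA.
rewrite charlier_coef ?mulf_neq0 ?pnatr_eq0 // -phiX.
rewrite /fderiv /= subSn // /eulerA -/G -[fmul _ _ _]/(H _).
(* Here [n!] splits as [C(n,l) l! (n-l)!]; the factor [n-l+1] from the derivative turns [(n-l)!]
   into the factorial inside [eulerA]. *)
rewrite -(bin_fact ln) factS !natrM; ring.
Qed.
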